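(* Let $n\ge k\ge 3$ be integers. Every regular intersecting family $\mathcal{F}\subset\binom{[n]}{k}$ satisfies $$|\mathcal{F}|\le \frac{\binom{n}{k}}{1+\frac{(n-k)(n-k-1)(n-k-2)}{k(k-1)(k-2)}}.$$
   Context: $[n]=\{1,\dots,n\}$ and $\binom{[n]}{k}$ is the set of $k$-element subsets of $[n]$. A family is intersecting if any two of its members intersect; it is regular if every element of $[n]$ lies in the same number of members of the family.
   Formalization: The theorem is proved under the additional assumption that n ≤ k+2 or n ≥ 2k; for k+3 ≤ n < 2k the claim is false, since the family of all k-element subsets of [n] is regular and intersecting and exceeds the bound. *)

(* Defs.v *)
From mathcomp Require Import all_boot.

Set Implicit Arguments.
Unset Strict Implicit.
Unset Printing Implicit Defensive.

(* The ground set {1, ..., n} is represented by 'I_n = {0, ..., n-1}. *)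

Definition ksubsets (n k : nat) : {set {set 'I_n}} :=
  [set A : {set 'I_n} | #|A| == k].

(* A and B may coincide; this only excludes the empty set as a member. *)
Definition intersecting (n : nat) (F : {set {set 'I_n}}) : Prop :=
  forall A B : {set 'I_n}, A \in F -> B \in F -> A :&: B != set0.

Definition degree (n : nat) (F : {set {set 'I_n}}) (x : 'I_n) : nat :=
  #|[set A in F | x \in A]|.

Definition regular (n : nat) (F : {set {set 'I_n}}) : Prop :=
  forall x y : 'I_n, degree F x = degree F y.

(* Main.v *)
(* For n >= 2k this is Hoffman's ratio bound for the Kneser graph on the k-subsets
   of an n-set.  Its i-th eigenvalue is (-1)^i C(n-k-i, k-i); regularity makes the
   centered indicator function 1_F - |F|/C(n,k) orthogonal to the eigenspaces
   i = 0 and i = 1, so the relevant least eigenvalue is the one at i = 3.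
   The spectrum is obtained without linear algebra: if h lives on i-sets and sums
   to 0 over the i-sets above any smaller set, inclusion-exclusion gives
   sum_(S disjoint from A) h S = (-1)^i sum_(S inside A) h S.  Applied once, this
   shows that the lift of h to k-sets is a Kneser eigenvector; applied twice, that
   lifting h and pushing it back down multiplies it by C(n-2i, k-i) > 0, so the
   i-th component of a function can be peeled off explicitly.
   For n <= k + 2 the bound reduces to |F| <= C(n,k). *)
Require Import Defs.
From mathcomp Require Import all_boot all_order all_algebra.
From mathcomp Require Import ring lra zify.

Set Implicit Arguments.
Unset Strict Implicit.

Import Order.TTheory GRing.Theory Num.Theory.
Local Open Scope ring_scope.

(** * Kneser quadratic form on null designs *)

Section KneserForm.

Variables (R : realFieldType) (T : finType).
Implicit Types (f g h : {set T} -> R) (A B S X : {set T}) (i j k t : nat).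

Lemma sum_signed_subsets B :
  \sum_(X : {set T} | X \subset B) (-1) ^+ #|X| = (B == set0)%:R :> R.
Proof.
(* Expand over subsets the product of a_x + 1, where a_x is -1 on [B] and 0 elsewhere; a subset not
   inside [B] picks up a factor 0. *)
have := bigA_distr 1 +%R (fun x : T => if x \in B then -1 else 0 : R)
  (fun=> 1); rewrite /= => E.
transitivity (\prod_(x : T) ((if x \in B then -1 else 0 : R) + 1)).
  rewrite E [LHS]big_mkcond /=; apply: eq_bigr => X _.
  rewrite -big_mkcond /=; case: ifPn => [/subsetP sXB | /subsetPn[x xX xB]].
    by rewrite -prodr_const; apply: eq_bigr => x /sXB ->.
  by rewrite (bigD1 x) //= (negPf xB) mul0r.
have [-> | [x xB]] := set_0Vmem B.
  by rewrite eqxx big1 // => x _; rewrite inE add0r.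
rewrite (bigD1 x) //= xB addNr mul0r; case: eqP xB => // ->; by rewrite inE.
Qed.

Lemma card_between A B k : A \subset B -> (#|A| <= k)%N ->
  (\sum_(X : {set T} | (#|X| == k) && (A \subset X) && (X \subset B)) 1)%N =
  'C(#|B| - #|A|, k - #|A|).
Proof.
move=> sAB leAk.
rewrite (reindex_onto (fun Y => A :|: Y) (fun X => X :\: A)) /=; last first.
  by move=> X /andP[/andP[_ /setIidPr sAX] _]; rewrite -{1}sAX setID.
have cBA : #|B :\: A| = (#|B| - #|A|)%N by rewrite cardsD (setIidPr sAB).
rewrite -cBA -cards_draws -sum1_card; apply: eq_bigl => Y; rewrite inE.
rewrite subUset sAB subsetUl andbT /= setDUl setDv set0U subsetD.
rewrite (sameP eqP setDidPl).
have [dYA | _] := boolP [disjoint Y & A]; last by rewrite !andbF.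
rewrite !andbT andbC; congr (_ && _).
by rewrite cardsU setIC (disjoint_setI0 dYA) cards0; apply/eqP/eqP; lia.
Qed.

(** When 2k <= |T| and t <= k + 1, this is orthogonality to the eigenspaces 0, ..., t - 1 of the
    Johnson scheme on k-sets. For t = k these are the harmonic functions. *)
Definition null_design k t f :=
  forall X, (#|X| < t)%N ->
    \sum_(A : {set T} | (#|A| == k) && (X \subset A)) f A = 0.

Definition up i h A := \sum_(S : {set T} | (#|S| == i) && (S \subset A)) h S.

Definition kneser k g A :=
  \sum_(B : {set T} | (#|B| == k) && [disjoint B & A]) g B.

Definition dot k f g := \sum_(A : {set T} | #|A| == k) f A * g A.

(** The indicator that S misses [A] is the sum of (-1)^|X| over X inside both. For fixed X, the sum
    of [h] over i-sets above X is 0 if |X| < i by harmonicity, empty if |X| > i, and [h X] if |X| =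
    i. *)
Lemma sum_disjoint_harmonic i h A : null_design i i h ->
  kneser i h A = (-1) ^+ i * up i h A.
Proof.
move=> hh; rewrite /kneser.
transitivity (\sum_(S : {set T} | #|S| == i)
   \sum_(X : {set T} | (X \subset A) && (X \subset S)) (-1) ^+ #|X| * h S).
  rewrite big_mkcondr /=; apply: eq_bigr => S _.
  rewrite -mulr_suml.
  under eq_bigl do rewrite -subsetI.
  rewrite sum_signed_subsets -setI_eq0 setIC.
  by case: eqP; rewrite ?mul1r ?mul0r.
rewrite (exchange_big_dep (fun X => X \subset A)) /=; last by move=> S X _ /andP[].
rewrite mulr_sumr [RHS]big_mkcond [LHS]big_mkcond /=; apply: eq_bigr => X _.
case: ifP => [XA | ]; rewrite ?andbF // andbT -mulr_sumr /=.
under eq_bigl do rewrite XA /=.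
case: (ltngtP #|X| i) => [/hh E | ltiX | eqX].
- by rewrite E mulr0.
- rewrite big1 ?mulr0 // => S /andP[/eqP Si /subset_leq_card].
  by rewrite Si leqNgt ltiX.
rewrite (big_pred1 X) ?eqX // => S /=; rewrite [RHS]eq_sym eqEcard eqX andbC.
case XS : (X \subset S) => //=.
by rewrite eqn_leq -[X in _ && (X <= _)%N]eqX subset_leq_card // andbT.
Qed.

(** Each i-set disjoint from [A] lies in the same number of k-sets disjoint from [A], so swapping
    sums leaves a multiple of [kneser i h A]. *)
Lemma kneser_up i k h A : null_design i i h -> #|A| = k -> (i <= k)%N ->
  kneser k (up i h) A =
  (-1) ^+ i * 'C(#|T| - k - i, k - i)%:R * up i h A.
Proof.
move=> hh Ak leik; rewrite mulrAC -(sum_disjoint_harmonic A hh) /kneser /up.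
rewrite (exchange_big_dep (fun S => (#|S| == i) && [disjoint S & A])) /=; last first.
  move=> B S /andP[_ dBA] /andP[-> SB] /=.
  by rewrite (disjointWl SB).
rewrite mulr_suml; apply: eq_bigr => S /andP[/eqP Si dSA].
rewrite sumr_const [RHS]mulr_natr; congr (_ *+ _).
have sSA : S \subset ~: A by rewrite subsetC -disjoints_subset disjoint_sym.
have := card_between sSA; rewrite Si => /(_ _ leik).
rewrite cardsCs setCK Ak => <-; rewrite -sum1_card; apply: eq_bigl => B.
by rewrite unfold_in eqxx /= disjoints_subset andbAC.
Qed.

(** With containment of S in A traded for disjointness, the A to count lie between [X] and the
    complement of S: their number does not depend on S. *)
Lemma down_up i k h X : null_design i i h -> (#|X| <= k)%N -> (i <= k)%N ->
  \sum_(A : {set T} | (#|A| == k) && (X \subset A)) up i h A =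
  'C(#|T| - i - #|X|, k - #|X|)%:R * up i h X.
Proof.
move=> hh leXk leik.
have flip A : up i h A = (-1) ^+ i * kneser i h A.
  by rewrite (sum_disjoint_harmonic A hh) mulrA -exprMn mulrNN mulr1 expr1n mul1r.
under eq_bigr do rewrite flip.
rewrite flip -mulr_sumr mulrCA; congr (_ * _); rewrite /kneser.
rewrite (exchange_big_dep (fun S => (#|S| == i) && [disjoint S & X])) /=; last first.
  move=> A S /andP[_ XA] /andP[-> SA] /=.
  by rewrite (disjointWr XA).
rewrite mulr_sumr; apply: eq_bigr => S /andP[/eqP Si dSX].
rewrite sumr_const [RHS]mulr_natl; congr (_ *+ _).
have sXS : X \subset ~: S by rewrite -disjoints_subset disjoint_sym.
have := card_between sXS leXk.
rewrite cardsCs setCK Si => <-; rewrite -sum1_card; apply: eq_bigl => A.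
by rewrite unfold_in eqxx /= disjoint_sym disjoints_subset.
Qed.

Lemma kneser_sym k f g : dot k f (kneser k g) = dot k (kneser k f) g.
Proof.
rewrite /dot /kneser.
under eq_bigr do rewrite mulr_sumr.
under [RHS]eq_bigr do rewrite mulr_suml.
under eq_bigr do rewrite big_mkcondr /=.
under [RHS]eq_bigr do rewrite big_mkcondr /=.
by rewrite exchange_big /=; apply: eq_bigr => A _; apply: eq_bigr => B _;
  rewrite disjoint_sym.
Qed.

(** [up] is adjoint to summing over supersets. *)
Lemma dot_up_null_design k t h g : null_design k t.+1 g -> dot k (up t h) g = 0.
Proof.
move=> hg; rewrite /dot /up.
under eq_bigr do rewrite mulr_suml.
rewrite (exchange_big_dep (fun S => #|S| == t)) /=; last by move=> A S _ /andP[].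
apply: big1 => S /eqP St; rewrite -mulr_sumr.
rewrite (eq_bigl (fun A => (#|A| == k) && (S \subset A))) => [|A].
  by rewrite hg ?St // mulr0.
by rewrite St eqxx.
Qed.

Lemma null_design_full k f A : null_design k k.+1 f -> #|A| = k -> f A = 0.
Proof.
move=> hf Ak; have := hf A; rewrite Ak => /(_ (ltnSn k)).
rewrite (big_pred1 A) // => B /=; rewrite [RHS]eq_sym eqEcard Ak andbC.
case sAB: (A \subset B) => //=.
by rewrite eqn_leq -[X in _ && (X <= _)%N]Ak subset_leq_card // andbT.
Qed.

(** Double counting: all k-sets above X contain equally many t-sets above X. *)
Lemma down_null_design k t f : (t <= k)%N -> null_design k t f ->
  null_design t t
    (fun S => \sum_(A : {set T} | (#|A| == k) && (S \subset A)) f A).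
Proof.
move=> letk hf X ltXt.
rewrite (exchange_big_dep (fun A => (#|A| == k) && (X \subset A))) /=; last first.
  by move=> S A /andP[_ XS] /andP[-> SA]; rewrite (subset_trans XS).
transitivity (\sum_(A : {set T} | (#|A| == k) && (X \subset A))
   f A * 'C(k - #|X|, t - #|X|)%:R).
  apply: eq_bigr => A /andP[/eqP Ak XA].
  rewrite sumr_const [RHS]mulr_natr; congr (_ *+ _).
  have := card_between XA (ltnW ltXt); rewrite Ak => <-.
  by rewrite -sum1_card; apply: eq_bigl => S; rewrite unfold_in eqxx.
by rewrite -mulr_suml hf // mul0r.
Qed.

(* Induction on k + 1 - t: remove from f its component up t h of level t, which is
   orthogonal to the remainder g because g is a null design of strength t + 1. *)
Lemma kneser_form_ge k t c f : (k.*2 <= #|T|)%N -> (t <= k.+1)%N ->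
  (forall i, (t <= i <= k)%N ->
     - c <= (-1) ^+ i * 'C(#|T| - k - i, k - i)%:R :> R) ->
  null_design k t f -> - c * dot k f f <= dot k f (kneser k f).
Proof.
move=> lekn; have [m] := ubnP (k.+1 - t)%N.
elim: m t f => // m IHm t f ltm letk hc hf.
have [eqt | netk] := eqVneq t k.+1.
  rewrite eqt in hf; rewrite /dot !big1 ?mulr0 // => A /eqP Ak;
  by rewrite (null_design_full hf Ak) mul0r.
have {}letk : (t <= k)%N by lia.
pose d S := \sum_(A : {set T} | (#|A| == k) && (S \subset A)) f A.
(* The [down_up] factor at i = |X| = t. After division by it, [up t h] and [f] have equal sums above
   every t-set, so [g] gains one level. *)
pose mu : R := 'C(#|T| - t - t, k - t)%:R.
have mu0 : mu != 0 by rewrite pnatr_eq0 -lt0n bin_gt0; lia.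
pose h S := mu^-1 * d S.
have hh : null_design t t h.
  move=> X ltXt; rewrite -mulr_sumr.
  by rewrite (down_null_design letk hf) // mulr0.
pose g A := f A - up t h A.
have up_small X : (#|X| <= t)%N -> up t h X = if #|X| == t then h X else 0.
  move=> leXt; rewrite /up; case: eqP => [Xt | /eqP Xt].
    rewrite (big_pred1 X) // => S /=; rewrite eqEcard Xt andbC.
    case SX : (S \subset X) => //=.
    by rewrite eqn_leq -[X in (_ <= X)%N && _]Xt subset_leq_card.
  rewrite big1 // => S /andP[/eqP St /subset_leq_card].
  by rewrite St; move: leXt Xt; lia.
have hg : null_design k t.+1 g.
  move=> X leXt; rewrite sumrB down_up ?up_small //; try lia.
  case: eqP => [Xt | /eqP Xt]; last by rewrite mulr0 subr0 hf //; lia.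
  by rewrite Xt /h -/mu mulrA mulfV // mul1r subrr.
pose u := up t h; set lam : R := (-1) ^+ t * 'C(#|T| - k - t, k - t)%:R.
have Eku A : #|A| = k -> kneser k u A = lam * u A.
  by move=> Ak; rewrite /u kneser_up.
have ug0 : dot k u g = 0 by apply: dot_up_null_design.
have fE A : f A = u A + g A by rewrite /g /u addrC subrK.
have knf A : kneser k f A = kneser k u A + kneser k g A.
  by rewrite /kneser -big_split; apply: eq_bigr => B _; apply: fE.
have Eff : dot k f f = dot k u u + 2 * dot k u g + dot k g g.
  rewrite /dot mulr_sumr -!big_split; apply: eq_bigr => A _ /=.
  by rewrite !fE; ring.
have Ekf : dot k f (kneser k f) =
   lam * dot k u u + lam * dot k u g + dot k u (kneser k g) + dot k g (kneser k g).
  rewrite /dot !mulr_sumr -!big_split; apply: eq_bigr => A /eqP Ak /=.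
  by rewrite knf !fE Eku //; ring.
have Eug : dot k u (kneser k g) = lam * dot k u g.
  rewrite kneser_sym /dot mulr_sumr; apply: eq_bigr => A /eqP Ak.
  by rewrite Eku // mulrA.
have uu0 : 0 <= dot k u u by apply: sumr_ge0 => A _; rewrite -expr2 sqr_ge0.
have : - c * dot k g g <= dot k g (kneser k g).
  apply: (IHm t.+1) => //; try lia.
  by move=> i /andP[lti leik]; apply: hc; rewrite (ltnW lti).
(* As [u] and [g] are orthogonal and [u] is an eigenvector, the inequality splits into this one for
   [u] and the induction hypothesis for [g]. *)
have : - c <= lam by apply: hc; rewrite leqnn.
rewrite Ekf Eff Eug ug0 => hl; have := ler_wpM2r uu0 hl; lra.
Qed.

End KneserForm.

(** * Ratio bound for regular intersecting families *)

Lemma card_ksubsets n k : #|ksubsets n k| = 'C(n, k).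
Proof. by rewrite /ksubsets card_draws card_ord. Qed.

Lemma regular_degree n k (F : {set {set 'I_n}}) x :
  F \subset ksubsets n k -> regular F -> (n * degree F x = k * #|F|)%N.
Proof.
move=> /subsetP hF hreg.
transitivity (\sum_(y : 'I_n) degree F y)%N.
  by rewrite (eq_bigr (fun=> degree F x)) ?sum_nat_const ?card_ord // => y _; exact: hreg.
under eq_bigr => y _ do rewrite /degree -sum1dep_card big_mkcondr /=.
rewrite exchange_big /= -sum1_card big_distrr /=; apply: eq_bigr => A /hF.
by rewrite inE muln1 -big_mkcond sum1_card => /eqP.
Qed.

Lemma sum_ksubsets_above n k (X : {set 'I_n}) (a : rat) : (#|X| <= k)%N ->
  \sum_(A : {set 'I_n} | (#|A| == k) && (X \subset A)) a =
  a * 'C(n - #|X|, k - #|X|)%:R.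
Proof.
move=> leXk; rewrite sumr_const mulr_natr; congr (_ *+ _).
rewrite -[n in (n - _)%N]card_ord -cardsT -(card_between (subsetT X) leXk).
by rewrite -sum1_card; apply: eq_bigl => A; rewrite unfold_in subsetT andbT.
Qed.

(** Only the empty set and singletons are tested: the centering constant settles the former,
    regularity the latter. *)
Lemma centered_null_design n k (F : {set {set 'I_n}}) : (0 < k <= n)%N ->
  F \subset ksubsets n k -> regular F ->
  null_design k 2 (fun A => (A \in F)%:R - #|F|%:R / 'C(n, k)%:R : rat).
Proof.
move=> /andP[k0 lekn] hF hreg X ltX2.
have Ck0 : ('C(n, k)%:R : rat) != 0 by rewrite pnatr_eq0 -lt0n bin_gt0.
have leXk : (#|X| <= k)%N by lia.
rewrite sumrB sum_ksubsets_above // -natr_sum.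
have -> : (\sum_(A : {set 'I_n} | (#|A| == k) && (X \subset A)) (A \in F) =
           #|[set A in F | X \subset A]|)%N.
  rewrite -sum1_card [LHS]big_mkcond [RHS]big_mkcond; apply: eq_bigr => A _ /=.
  rewrite inE; case AF : (A \in F) => /=; last by case: ifP.
  by have := subsetP hF A AF; rewrite inE => ->.
case X0: #|X| ltX2 => [|[|//]] _.
  move/eqP: X0; rewrite cards_eq0 => /eqP ->; rewrite !subn0.
  have -> : [set A in F | set0 \subset A] = F by apply/setP => A; rewrite inE sub0set andbT.
  by rewrite mulfVK // subrr.
move/eqP/cards1P: X0 => [x ->].
have -> : #|[set A in F | [set x] \subset A]| = degree F x.
  by apply: eq_card => A; rewrite !inE sub1set.
have n0 : (n%:R : rat) != 0 by rewrite pnatr_eq0; lia.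
(* The factor n allows n * degree = k|F| and n C(n-1, k-1) = k C(n, k) to be used. *)
apply: (mulfI n0); rewrite mulr0 mulrBr -natrM (regular_degree x hF hreg).
rewrite mulrCA -natrM subn1 mul_bin_diag subn1 prednK //.
by rewrite natrM [(k * _)%:R]natrM; field.
Qed.

Lemma regular_intersecting_ratio n k (c : rat) (F : {set {set 'I_n}}) :
  (0 < k)%N -> (k.*2 <= n)%N -> 0 <= c ->
  (forall i, (2 <= i <= k)%N -> - c <= (-1) ^+ i * 'C(n - k - i, k - i)%:R) ->
  F \subset ksubsets n k -> intersecting F -> regular F ->
  'C(n - k, k)%:R * #|F|%:R <= c * ('C(n, k)%:R - #|F|%:R).
Proof.
move=> k0 lekn c0 hc hF hint hreg.
have lekn' : (0 < k <= n)%N by lia.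
have hf := centered_null_design lekn' hF hreg.
set N : rat := 'C(n, k)%:R in hf *; set L : rat := 'C(n - k, k)%:R.
set m : rat := #|F|%:R in hf *.
have N0 : 0 < N by rewrite ltr0n bin_gt0; lia.
pose a : rat := m / N; pose e (A : {set 'I_n}) : rat := (A \in F)%:R.
pose one (A : {set 'I_n}) : rat := 1.
have aN : a * N = m by rewrite mulfVK // gt_eqF.
have dot11 : dot k one one = N.
  rewrite /dot /one; under eq_bigr do rewrite mulr1.
  have := @sum_ksubsets_above n k set0 1; rewrite cards0 !subn0 mul1r /N => <- //.
  by apply: eq_bigl => A; rewrite sub0set andbT.
have dot1e : dot k one e = m.
  rewrite /dot /one /e; under eq_bigr do rewrite mul1r.
  rewrite -natr_sum; congr (_%:R); rewrite -sum1_card [LHS]big_mkcond [RHS]big_mkcond.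
  apply: eq_bigr => A _ /=; case AF: (A \in F); last by case: ifP.
  by have := subsetP hF A AF; rewrite inE => ->.
have dotee : dot k e e = m.
  rewrite -dot1e; apply: eq_bigr => A _; rewrite /e /one mul1r.
  by case: (A \in F); rewrite ?mulr1 ?mulr0.
have eKe : dot k e (kneser k e) = 0.
  rewrite /dot big1 // => A _; rewrite /kneser mulr_sumr big1 // => B /andP[_].
  rewrite /e; case AF: (A \in F); case BF: (B \in F); rewrite ?mulr0 ?mul0r //.
  by have := hint B A BF AF; rewrite setI_eq0 => /negPf ->.
have K1 (A : {set 'I_n}) : #|A| = k -> kneser k one A = L.
  move=> Ak; rewrite /kneser sumr_const /L; congr (_%:R).
  have := card_between (sub0set (~: A)) (_ : (_ <= k)%N).
  rewrite cards0 cardsCs setCK card_ord Ak !subn0 => <- //; rewrite -sum1_card.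
  by apply: eq_bigl => B; rewrite unfold_in sub0set andbT disjoints_subset.
have dot1Ke : dot k one (kneser k e) = L * m.
  rewrite kneser_sym -dot1e /dot mulr_sumr; apply: eq_bigr => A /eqP Ak.
  by rewrite K1 // mul1r.
pose f (A : {set 'I_n}) : rat := e A - a.
have fE (A : {set 'I_n}) : f A = e A - a * one A by rewrite /f mulr1.
have Kf (A : {set 'I_n}) : #|A| = k -> kneser k f A = kneser k e A - a * L.
  move=> Ak; rewrite -(K1 A Ak) /kneser mulr_sumr -sumrB.
  by apply: eq_bigr => B _; exact: fE.
have Eff : dot k f f = dot k e e - 2 * a * dot k one e + a ^+ 2 * dot k one one.
  rewrite /dot !mulr_sumr -sumrB -big_split; apply: eq_bigr => A _ /=.
  rewrite !fE. ring.
have Efk : dot k f (kneser k f) = dot k e (kneser k e) - a * dot k one (kneser k e)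
    - a * L * dot k one e + a ^+ 2 * L * dot k one one.
  rewrite /dot !mulr_sumr -!sumrB -big_split; apply: eq_bigr => A /eqP Ak /=.
  by rewrite Kf // fE /one; ring.
have : - c * dot k f f <= dot k f (kneser k f).
  by apply: kneser_form_ge hf; rewrite ?card_ord //; lia.
rewrite Eff Efk dot11 dot1e dotee eKe dot1Ke => H.
(* Both forms evaluate to -a L m >= -c (m - a m); multiply by N and use a N = m. *)
have {}H : L * m * m <= c * (N - m) * m.
  have := ler_wpM2r (ltW N0) H; rewrite -aN; nra.
have [m0 | m0] := eqVneq m 0.
  by rewrite m0 mulr0 subr0 mulr_ge0 // ltW.
by rewrite -(ler_pM2r (_ : 0 < m)) // lt_def m0 ler0n.
Qed.

(** * Binomial comparisons and the final bound *)

Lemma leq_bin_addr a b d : ('C(a, b) <= 'C(a + d, b + d))%N.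
Proof.
by elim: d => [|d IHd]; rewrite ?addn0 // !addnS binS (leq_trans IHd) ?leq_addl.
Qed.

(** With p = n - k - 3 and q = k - 3, this turns the fraction of the theorem into C(n-k, k) /
    C(n-k-3, k-3). *)
Lemma bin_diag3 p q :
  (p.+3 * p.+2 * p.+1 * 'C(p, q) = q.+3 * q.+2 * q.+1 * 'C(p.+3, q.+3))%N.
Proof.
have E3 := mul_bin_diag p.+3 q.+2; have E2 := mul_bin_diag p.+2 q.+1.
have E1 := mul_bin_diag p.+1 q; rewrite /= in E1 E2 E3.
by rewrite -mulnA E1 mulnACA E2 [(q.+2 * _)%N]mulnC mulnACA E3 mulnAC (mulnC q.+1) !mulnA.
Qed.

(** [hn] excludes k + 3 <= n < 2k, where the family of all k-sets is regular and intersecting but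
    exceeds the bound. *)
Theorem theorem11 (n k : nat) (hk : (3 <= k)%N) (hkn : (k <= n)%N)
    (hn : (n <= k + 2)%N \/ (2 * k <= n)%N)
    (F : {set {set 'I_n}}) (hF : F \subset ksubsets n k)
    (hint : intersecting F) (hreg : regular F) :
  (#|F|%:R : rat) <=
    'C(n, k)%:R /
      (1 + ((n%:R - k%:R) * (n%:R - k%:R - 1) * (n%:R - k%:R - 2%:R)) /
           (k%:R * (k%:R - 1) * (k%:R - 2%:R))).
Proof.
have [len | ltn] := leqP n (k + 2).
  have -> : (n%:R - k%:R) * (n%:R - k%:R - 1) * (n%:R - k%:R - 2%:R) = 0 :> rat.
    have -> : n = (k + (n - k))%N by rewrite subnKC.
    have : (n - k < 3)%N by lia.
    by case: (n - k)%N => [|[|[|j]]] // _; rewrite natrD; ring.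
  by rewrite mul0r addr0 divr1 ler_nat -card_ksubsets subset_leq_card.
have lekn : (k.*2 <= n)%N by lia.
set c : rat := 'C(n - k - 3, k - 3)%:R.
have c0 : 0 < c by rewrite ltr0n bin_gt0; lia.
(* Even levels have nonnegative eigenvalues; at odd levels i >= 3 the absolute value is at most that
   at i = 3, by Pascal's rule. *)
have hc i : (2 <= i <= k)%N ->
    - c <= (-1) ^+ i * 'C(n - k - i, k - i)%:R.
  move=> /andP[le2i leik]; rewrite -signr_odd; case: (boolP (odd i)) => oi.
    rewrite expr1 mulN1r lerN2 ler_nat.
    have le3i : (3 <= i)%N by case: i le2i oi {leik} => [|[|[|]]].
    have := leq_bin_addr (n - k - i) (k - i) (i - 3).
    by congr (_ <= 'C(_, _))%N; lia.
  by rewrite expr0 mul1r (le_trans (_ : _ <= 0)) ?oppr_le0 ?ler0n // ltW.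
have := regular_intersecting_ratio (_ : 0 < k)%N lekn (ltW c0) hc hF hint hreg.
move=> /(_ (ltn_trans (isT : 0 < 2)%N hk)).
set L : rat := 'C(n - k, k)%:R; set N : rat := 'C(n, k)%:R => H.
have -> : (n%:R - k%:R) * (n%:R - k%:R - 1) * (n%:R - k%:R - 2%:R) /
    (k%:R * (k%:R - 1) * (k%:R - 2%:R)) = L / c :> rat.
  rewrite -natrB // /L; rewrite /c in c0 *.
  have [p Ep] : exists p, (n - k = p.+3)%N by exists (n - k - 3)%N; lia.
  have [q Eq] : exists q, (k = q.+3)%N by exists (k - 3)%N; lia.
  rewrite Ep Eq !subSS !subn0 in c0 *.
  have /(congr1 (fun z => z%:R : rat)) := bin_diag3 p q.
  rewrite !natrM => E.
  have E1 r : (r.+3%:R - 1 = r.+2%:R :> rat) by rewrite -[r.+3]addn1 natrD addrK.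
  have E2 r : (r.+3%:R - 2%:R = r.+1%:R :> rat) by rewrite -[r.+3]addn2 natrD addrK.
  have d0 : 0 < q.+3%:R * q.+2%:R * q.+1%:R :> rat by rewrite !mulr_gt0 ?ltr0n.
  rewrite !E1 !E2; apply/eqP; rewrite (eqr_div _ _ (lt0r_neq0 d0) (lt0r_neq0 c0)).
  by rewrite E mulrC.
have L0 : 0 <= L / c by rewrite divr_ge0 ?ler0n.
(* |F| (1 + L / c) <= N, multiplied by c, is a rearrangement of [H]. *)
rewrite ler_pdivlMr ?ltr_wpDr // -(ler_pM2r c0) mulrDr mulr1 mulrDl -!mulrA.
by rewrite mulVf ?gt_eqF // mulr1; move: H; rewrite mulrBr; lra.
Qed.
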